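(* Fix $k\in\mathbb{Z}_{\geq 1}$ and a set of patterns $B\subseteq\mathcal S$. Then the feasible region $P^{\mathrm{Av}(B)}_k$ is a closed subset of $[0,1]^{\mathcal S_k}$ and $$P^{\mathrm{Av}(B)}_k\subseteq P(\mathcal{O}v(k,\mathrm{Av}(B)))\subseteq P_k .$$ Moreover, if $\mathrm{Av}(B)$ is closed under the operation $\oplus$ or closed under the operation $\ominus$, then $P^{\mathrm{Av}(B)}_k$ is convex and $\dim(P^{\mathrm{Av}(B)}_k)\leq |\mathrm{Av}_k(B)|-|\mathrm{Av}_{k-1}(B)|$. In particular, for every single pattern $\tau\in\mathcal S$, $P^{\mathrm{Av}(\tau)}_k$ is convex.
   Context: For $n\ge1$, $\mathcal S_n$ is the set of permutations of $[n]=\{1,\dots,n\}$ in one-line notation, $\mathcal S=\bigcup_{n\ge1}\mathcal S_n$; by convention $\mathcal S_0$ and $\mathrm{Av}_0(B)$ consist of the empty permutation. For distinct reals $x_1,\dots,x_m$, $\mathrm{std}(x_1,\dots,x_m)$ is the unique $\pi\in\mathcal S_m$ with $\pi(i)<\pi(j)\iff x_i<x_j$. For $\sigma\in\mathcal S_n$ and $I=\{i_1<\dots<i_m\}\subseteq[n]$, $\mathrm{pat}_I(\sigma)=\mathrm{std}(\sigma(i_1),\dots,\sigma(i_m))$. A permutation $\sigma$ contains $\pi$ if $\mathrm{pat}_I(\sigma)=\pi$ for some $I$, and avoids $\pi$ otherwise. For $B\subseteq\mathcal S$, $\mathrm{Av}_n(B)$ is the set of permutations of size $n$ avoiding every element of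 $B$, and $\mathrm{Av}(B)=\bigcup_{n\ge1}\mathrm{Av}_n(B)$; $\mathrm{Av}(\tau)=\mathrm{Av}(\{\tau\})$. For $\pi\in\mathcal S_k$, $\sigma\in\mathcal S_n$, $\mathrm{c\text{-}occ}(\pi,\sigma)$ is the number of intervals $I=\{i,i+1,\dots,i+k-1\}\subseteq[n]$ with $\mathrm{pat}_I(\sigma)=\pi$, and $\widetilde{\mathrm{c\text{-}occ}}(\pi,\sigma)=\mathrm{c\text{-}occ}(\pi,\sigma)/n$. Feasible region: $P^{\mathrm{Av}(B)}_k$ is the set of $\vec v\in[0,1]^{\mathcal S_k}$ for which there is a sequence $(\sigma^m)_{m\ge1}$ in $\mathrm{Av}(B)$ with $|\sigma^m|\to\infty$ and $\widetilde{\mathrm{c\text{-}occ}}(\pi,\sigma^m)\to\vec v_\pi$ for all $\pi\in\mathcal S_k$; $P_k$ denotes this set when $B=\emptyset$ (all permutations allowed). Graphs are directed multigraphs (loops and parallel edges allowed); $\mathrm{st}(e),\mathrm{ar}(e)$ denote start and arrival vertex of edge $e$. A walk is a sequence of edges $(e_1,\dots,e_m)$ with $\mathrm{ar}(e_i)=\mathrm{st}(e_{i+1})$; it is a cycle if $\mathrm{st}(e_1)=\mathrm{ar}(e_m)$, and a simple cycle if moreover its edges are distinct and the vertices $\mathrm{st}(e_1),\dots,\mathrm{st}(e_m)$ are distinct. For a nonempty cycle $\mathcal C$ of $G=(V,E)$, $\vec e_{\mathcal C}\in\mathbb R^E$ has $e$-coordinate equal to (number of occurrences of $e$ in $\mathcal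 C$)$/|\mathcal C|$. The cycle polytope is $P(G)=\mathrm{conv}\{\vec e_{\mathcal C}:\mathcal C\text{ a simple cycle of }G\}$. Overlap graph: $\mathcal{O}v(k,\mathrm{Av}(B))$ has vertex set $\mathrm{Av}_{k-1}(B)$ and, for each $\pi\in\mathrm{Av}_k(B)$, one edge labelled $\pi$ from $\mathrm{pat}_{\{1,\dots,k-1\}}(\pi)$ to $\mathrm{pat}_{\{2,\dots,k\}}(\pi)$. Since its edges are in bijection with $\mathrm{Av}_k(B)$, its cycle polytope lies in $\mathbb R^{\mathrm{Av}_k(B)}$, which is identified with the subspace of $\mathbb R^{\mathcal S_k}$ of vectors vanishing outside $\mathrm{Av}_k(B)$. Direct sum: for $\tau\in\mathcal S_m,\sigma\in\mathcal S_n$, $\tau\oplus\sigma=\tau(1)\cdots\tau(m)(\sigma(1)+m)\cdots(\sigma(n)+m)$; skew sum $\tau\ominus\sigma=(\tau(1)+n)\cdots(\tau(m)+n)\sigma(1)\cdots\sigma(n)$. $\mathrm{Av}(B)$ is closed under $\oplus$ if $\tau,\sigma\in\mathrm{Av}(B)$ implies $\tau\oplus\sigma\in\mathrm{Av}(B)$ (similarly for $\ominus$). The dimension of a convex set is the dimension of its affine hull. *)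

(* Defs.v *)
From HB Require Import structures.
From mathcomp Require Import all_boot all_order all_algebra all_fingroup.
From mathcomp Require Import all_classical all_reals all_analysis.
Unset Printing Implicit Defensive.
Import Order.TTheory GRing.Theory Num.Theory.
Import numFieldNormedType.Exports.
Local Open Scope classical_set_scope.
Local Open Scope ring_scope.

(* Permutations of size n are elements of 'S_n = {perm 'I_n}, with 0-based
   positions and values: sigma in 'S_n corresponds to the one-line word
   (sigma 0 + 1) ... (sigma (n-1) + 1). *)

Definition pval {n} (s : 'S_n) (t : nat) : nat :=
  match (insub t : option 'I_n) with Some i => val (s i) | None => 0%N end.

(* pat_isb s f p  <=>  std(s(f 0), ..., s(f (m-1))) = p *)
Definition pat_isb {n m} (s : 'S_n) (f : 'I_m -> nat) (p : 'S_m) : bool :=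
  [forall i : 'I_m, forall j : 'I_m,
     ((val (p i) < val (p j))%N == (pval s (f i) < pval s (f j))%N)].

Definition cpat {n} (s : 'S_n) (i m : nat) : 'S_m :=
  odflt 1%g [pick r : 'S_m | pat_isb s (fun a : 'I_m => (i + a)%N) r].

Definition contains {m n} (p : 'S_m) (s : 'S_n) : Prop :=
  exists f : 'I_m -> 'I_n,
    (forall a b : 'I_m, (a < b)%N -> (f a < f b)%N) /\
    pat_isb s (fun a => val (f a)) p.

(* a set of patterns B \subseteq S = \bigcup_{n>=1} S_n; the component B 0 is
   ignored *)
Definition patset := forall n, {set 'S_n}.

Definition avoids (B : patset) {n} (s : 'S_n) : Prop :=
  forall m (p : 'S_m.+1), p \in B m.+1 -> ~ contains p s.

Definition Av (B : patset) n : {set 'S_n} := finset (fun s : 'S_n => `[< avoids B s >]).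

Definition noB : patset := fun n => finset (fun s : 'S_n => false).

Definition single_B {m} (tau : 'S_m) : patset := fun n =>
  finset (fun s : 'S_n =>
    (n == m) && [forall i : 'I_n, pval s i == pval tau i]).

Definition cocc {k n} (p : 'S_k) (s : 'S_n) : nat :=
  #|finset (fun i : 'I_n =>
     (i + k <= n)%N && pat_isb s (fun a : 'I_k => (i + a)%N) p)|.

Definition seq_cvg {R : realType} (u : nat -> R) (l : R) : Prop :=
  u @ \oo --> l.

Definition feasible (R : realType) (B : patset) k : set ('S_k -> R) :=
  [set v : 'S_k -> R | exists s : nat -> {n : nat & 'S_n},
     (forall m, (0 < projT1 (s m))%N /\ avoids B (projT2 (s m))) /\
     (forall N, exists M, forall m, (M <= m)%N -> (N <= projT1 (s m))%N) /\
     (forall p : 'S_k,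
        seq_cvg (fun m => (cocc p (projT2 (s m)))%:R / (projT1 (s m))%:R) (v p))].

Definition unit_box (R : realType) k : set ('S_k -> R) :=
  [set v : 'S_k -> R | forall p, 0 <= v p <= 1].

(* Overlap graph Ov(k, Av(B)): edge p in Av_k(B) from st p to ar p *)
Definition st {k} (p : 'S_k) : 'S_k.-1 := cpat p 0 k.-1.
Definition ar {k} (p : 'S_k) : 'S_k.-1 := cpat p 1 k.-1.

Definition simple_cycle (B : patset) {k} (C : seq 'S_k) : Prop :=
  [/\ C != [::], all (fun e => e \in Av B k) C,
      (forall i : 'I_(size C),
         ar (nth 1%g C i) = st (nth 1%g C ((i + 1) %% size C))),
      uniq C & uniq (map (@st k) C)].

Definition cycle_vec (R : realType) {k} (C : seq 'S_k) : 'S_k -> R :=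
  fun p => (count_mem p C)%:R / (size C)%:R.

Definition conv_hull {R : realType} {V : Type} (S : set (V -> R)) : set (V -> R) :=
  [set x | exists m (w : 'I_m -> R) (y : 'I_m -> V -> R),
     [/\ forall i, 0 <= w i, \sum_i w i = 1, forall i, S (y i)
       & forall t, x t = \sum_i w i * y i t]].

Definition cycle_polytope (R : realType) (B : patset) k : set ('S_k -> R) :=
  conv_hull [set cycle_vec R C | C in @simple_cycle B k].

(* dim(P) <= d, dim = dimension of the affine hull (dim of empty set = -1):
   the affine hull of nonempty P is a + span{x - y | x, y in P}. *)
Definition dim_le {R : realType} {k} (P : set ('S_k -> R)) (d : int) : Prop :=
  (-1 <= d)%R /\
  ((exists a, P a) ->
   forall m (x y : 'I_m -> 'S_k -> R), (forall i, P (x i) /\ P (y i)) ->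
     ((\rank (\matrix_(i < m, j < #|{: 'S_k}|)
                 (x i (enum_val j) - y i (enum_val j))))%:Z <= d)%R).

Definition is_dsum {m n} (t : 'S_m) (s : 'S_n) (r : 'S_(m + n)) : bool :=
  [forall i : 'I_(m + n),
     pval r i == if (i < m)%N then pval t i else (pval s (i - m) + m)%N].
Definition is_ssum {m n} (t : 'S_m) (s : 'S_n) (r : 'S_(m + n)) : bool :=
  [forall i : 'I_(m + n),
     pval r i == if (i < m)%N then (pval t i + n)%N else pval s (i - m)].

Definition dsum_closed (B : patset) : Prop :=
  forall m n (t : 'S_m.+1) (s : 'S_n.+1) (r : 'S_(m.+1 + n.+1)),
    avoids B t -> avoids B s -> is_dsum t s r -> avoids B r.
Definition ssum_closed (B : patset) : Prop :=
  forall m n (t : 'S_m.+1) (s : 'S_n.+1) (r : 'S_(m.+1 + n.+1)),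
    avoids B t -> avoids B s -> is_ssum t s r -> avoids B r.

(* Main.v *)
Require Import Defs.
From HB Require Import structures.
From mathcomp Require Import all_boot all_order all_algebra all_fingroup.
From mathcomp Require Import all_classical all_reals all_analysis.
From mathcomp Require Import zify ring lra.
Import Order.TTheory GRing.Theory Num.Theory.
Import numFieldNormedType.Exports.
Local Open Scope classical_set_scope.
Local Open Scope ring_scope.

(** A vector is feasible iff for every e > 0 there are arbitrarily long
    permutations in Av(B) whose consecutive densities are e-close to it; hence
    the closedness.  The windows of size k of a permutation form a walk in the
    overlap graph, so feasible vectors are nonnegative circulations of total
    mass 1, and a circulation is a conic combination of simple cycles: subtract
    a largest multiple of a cycle of its support.  Conversely every walk in
    Ov(k, S) is the window sequence of some permutation, built by appending one
    value at a time.

    Closure under direct or skew sums enters only through the existence of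
    joins: a permutation of Av(B) whose first m and last n values are ordered
    like two given ones.  A join changes the numbers of occurrences by at most
    k, so densities of many joined copies average, which gives convexity.  Joins
    also connect the overlap graph, so conservation of flow and total mass impose
    |Av_{k-1}(B)| independent constraints on the edges.  For a single pattern
    tau, comparing its first and last values tells which of the two sums cannot
    create an occurrence of tau. *)

(* mathcomp.fingroup.perm exports another [pval]. *)
Local Notation pval := Defs.pval.

(** * Words, windows and joins *)

(* [ostd m f] is std(f 0, ..., f (m-1)); [cpat s i m] is by definition
   [ostd m (fun a => pval s (i + a))]. *)
Definition ostd m (f : nat -> nat) : 'S_m :=
  odflt 1%g [pick r : 'S_m | [forall i : 'I_m, forall j : 'I_m,
     ((val (r i) < val (r j))%N == (f i < f j)%N)]].

(** Words are total functions on [nat] read only below [m], so that windows are mere shifts and need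
    no casts between ordinal types. *)
Definition oiso m (f g : nat -> nat) :=
  forall a b, (a < m)%N -> (b < m)%N -> (f a < f b)%N = (g a < g b)%N.

Definition winj m (f : nat -> nat) :=
  forall a b, (a < m)%N -> (b < m)%N -> f a = f b -> a = b.

Lemma cpatE n (s : 'S_n) i m : cpat s i m = ostd m (fun a => pval s (i + a)%N).
Proof. by []. Qed.

Lemma pvalE n (s : 'S_n) (i : 'I_n) : pval s i = s i.
Proof. by rewrite /pval valK. Qed.

Lemma pval_lt n (s : 'S_n) i : (i < n)%N -> (pval s i < n)%N.
Proof. by move=> h; rewrite -[i]/(val (Ordinal h)) pvalE. Qed.

Lemma pval_winj n (s : 'S_n) : winj n (pval s).
Proof.
move=> a b ha hb.
rewrite -[a]/(val (Ordinal ha)) -[b]/(val (Ordinal hb)) !pvalE.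
by move=> /val_inj /perm_inj ->.
Qed.

Lemma winj_shift {m} {f : nat -> nat} i l :
  winj m f -> (i + l <= m)%N -> winj l (fun a => f (i + a)%N).
Proof. by move=> fi h a b ha hb /fi hab; apply: (@addnI i); apply: hab; lia. Qed.

Lemma oisoP m (p : 'S_m) f :
  reflect (oiso m (pval p) f)
    [forall i : 'I_m, forall j : 'I_m, ((val (p i) < val (p j))%N == (f i < f j)%N)].
Proof.
apply: (iffP forallP) => [h a b ha hb | h i]; last first.
  by apply/forallP => j; rewrite -h // !pvalE.
by have /forallP/(_ (Ordinal hb))/eqP /= := h (Ordinal ha);
  rewrite -!pvalE.
Qed.

Lemma oiso_sym m f g : oiso m f g -> oiso m g f.
Proof. by move=> h a b ha hb; rewrite h. Qed.

Lemma oiso_trans m f g h : oiso m f g -> oiso m g h -> oiso m f h.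
Proof. by move=> u v a b ha hb; rewrite u // v. Qed.

Lemma oiso_shift {m f g} i l : oiso m f g -> (i + l <= m)%N ->
  oiso l (fun a => f (i + a)%N) (fun a => g (i + a)%N).
Proof. by move=> h hl a b ha hb; apply: h; lia. Qed.

Lemma oiso_winj m f g : oiso m f g -> winj m f -> winj m g.
Proof.
move=> h fi a b ha hb e; apply: fi => //.
by have := h a b ha hb; have := h b a hb ha; lia.
Qed.

Lemma sum_ltn_ord m c : (\sum_(j < m) (j < c) = minn c m)%N.
Proof.
elim: m => [|m IH]; first by rewrite big_ord0 minn0.
by rewrite big_ord_recr /= IH; lia.
Qed.

Lemma perm_rank m (p : 'S_m) i : (\sum_(j < m) (p j < p i))%N = p i.
Proof.
transitivity (\sum_(j < m) (j < p i))%N; first by rewrite [RHS](reindex_inj (@perm_inj _ p)).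
by rewrite sum_ltn_ord; apply/minn_idPl; apply: ltnW.
Qed.

(** A value is the number of smaller values, so the relative order recovers it. *)
Lemma oiso_perm_inj m (p q : 'S_m) : oiso m (pval p) (pval q) -> p = q.
Proof.
move=> h; apply/permP => i; apply: val_inj => /=.
rewrite -(perm_rank m p) -(perm_rank m q); apply: eq_bigr => j _.
by rewrite -!pvalE h.
Qed.

(** The ranks [rk i], counting the letters smaller than letter [i], form a permutation with the
    required order. Hence the search in [ostd] succeeds and its default is not returned. *)
Lemma ostd_oiso m f : winj m f -> oiso m (pval (ostd m f)) f.
Proof.
move=> fi; rewrite /ostd; case: pickP => [r /oisoP //|no].
pose rk (i : 'I_m) := (\sum_(j < m) (f j < f i))%N.
have rkmono (a b : 'I_m) : (f a < f b)%N -> (rk a < rk b)%N.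
  move=> h; rewrite /rk (bigD1 a) //= [X in (_ < X)%N](bigD1 a) //= ltnn h.
  by rewrite ltnS add0n leq_sum // => j _; case: (ltnP (f j) (f a)) => //; lia.
have rkE (a b : 'I_m) : (rk a < rk b)%N = (f a < f b)%N.
  have [/rkmono->//|h] := ltnP (f a) (f b); apply/negbTE; rewrite -leqNgt.
  move: h; rewrite leq_eqVlt => /orP[/eqP h|/rkmono/ltnW //].
  by rewrite /rk h.
have rk_lt i : (rk i < m)%N.
  rewrite /rk (bigD1 i) //= ltnn add0n.
  apply: leq_ltn_trans (_ : \sum_(j < m | j != i) 1 < _)%N.
    by apply: leq_sum => j _; case: (_ < _)%N.
  rewrite sum1_card; have := cardC1 i; rewrite card_ord => ->.
  by case: (m) i => [[]|].
pose g i := Ordinal (rk_lt i).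
have gi : injective g.
  move=> a b /(congr1 val) /= hab; apply: val_inj; apply: (fi _ _ (ltn_ord a) (ltn_ord b)).
  by have := rkE a b; have := rkE b a; rewrite hab ltnn; case: ltngtP.
have /negP[] := negbT (no (perm gi)).
by apply/forallP => i; apply/forallP => j; rewrite !permE /= rkE.
Qed.

Lemma ostd_uniq m (p : 'S_m) f : oiso m (pval p) f -> ostd m f = p.
Proof.
move=> h; apply: oiso_perm_inj; apply: oiso_trans (oiso_sym _ _ _ h).
by apply: ostd_oiso; apply: oiso_winj h (pval_winj _ _).
Qed.

(** Both searches run over the same predicate, so they agree even when nothing fits. *)
Lemma ostd_ext m f g : oiso m f g -> ostd m f = ostd m g.
Proof.
move=> h; rewrite /ostd; congr odflt; apply: eq_pick => r.
by apply/oisoP/oisoP => h'; apply: (oiso_trans _ _ _ _ h') => //; exact: oiso_sym.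
Qed.

Lemma ostd_sub m f j l : winj m f -> (j + l <= m)%N ->
  cpat (ostd m f) j l = ostd l (fun a => f (j + a)%N).
Proof. by move=> fi h; exact: (ostd_ext _ _ _ (oiso_shift j l (ostd_oiso _ _ fi) h)). Qed.

Lemma cpat_oiso {n} (s : 'S_n) i m : (i + m <= n)%N ->
  oiso m (pval (cpat s i m)) (fun a => pval s (i + a)%N).
Proof. by move=> h; apply: ostd_oiso; apply: winj_shift (pval_winj _ _) h. Qed.

Lemma cpat_cpat {n} (s : 'S_n) i m j l : (i + m <= n)%N -> (j + l <= m)%N ->
  cpat (cpat s i m) j l = cpat s (i + j) l.
Proof.
move=> hi hj; rewrite [cpat s i m]cpatE ostd_sub //; last exact: winj_shift (pval_winj _ _) hi.
by rewrite [RHS]cpatE; apply: ostd_ext => a b _ _; rewrite !addnA.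
Qed.

Lemma cpat_full {n} (s : 'S_n) : cpat s 0 n = s.
Proof. by apply: ostd_uniq. Qed.

Lemma pat_isbP {n m} (s : 'S_n) (f : nat -> nat) (p : 'S_m) :
  reflect (oiso m (pval p) (fun a => pval s (f a)))
          (pat_isb s (fun a : 'I_m => f a) p).
Proof. exact: oisoP. Qed.

Lemma pat_isb_cpat {n k} (s : 'S_n) i (p : 'S_k) : (i + k <= n)%N ->
  pat_isb s (fun a : 'I_k => (i + a)%N) p = (cpat s i k == p).
Proof.
move=> h; apply/(pat_isbP s (fun a => i + a)%N)/eqP => [|<-]; first exact: ostd_uniq.
exact: cpat_oiso.
Qed.

Lemma coccE {n k} (s : 'S_n) (p : 'S_k) :
  cocc p s = (\sum_(i < n) ((i + k <= n) && (cpat s i k == p)))%N.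
Proof.
rewrite /cocc -sum1_card big_mkcond /=; apply: eq_bigr => i _.
rewrite inE; case: leqP => //= h; rewrite pat_isb_cpat //.
Qed.

Lemma contains_ext {m n n'} (p : 'S_m) (s : 'S_n) (s' : 'S_n') (g : nat -> nat) :
  (forall a b, (a < b < n)%N -> (g a < g b)%N) ->
  (forall a, (a < n)%N -> (g a < n')%N) ->
  oiso n (pval s) (fun a => pval s' (g a)) -> contains p s -> contains p s'.
Proof.
move=> gm gn h [f [fm /forallP fp]].
exists (fun a => Ordinal (gn _ (ltn_ord (f a)))); split.
  by move=> a b hab /=; apply: gm; rewrite fm //=.
apply/forallP => i; apply/forallP => j; have /forallP/(_ j)/eqP -> := fp i.
by rewrite (h _ _ (ltn_ord (f i)) (ltn_ord (f j))).
Qed.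

Lemma avoids_cpat B {n} (s : 'S_n) i m : (i + m <= n)%N ->
  avoids B s -> avoids B (cpat s i m).
Proof.
move=> h sB q p pB pc; apply: (sB q p pB).
apply: contains_ext (cpat_oiso s i m h) pc => [a b|a] /= hab; lia.
Qed.

Lemma AvP B n (s : 'S_n) : reflect (avoids B s) (s \in Av B n).
Proof. by rewrite inE; exact: asboolP. Qed.

Lemma st_cpat {n k} (s : 'S_n) i : (i + k <= n)%N -> st (cpat s i k) = cpat s i k.-1.
Proof. by move=> h; rewrite /st cpat_cpat ?addn0 //; lia. Qed.

(** With [st_cpat], this makes the windows a walk: the window at [i] arrives where the window at
    [i.+1] starts. *)
Lemma ar_cpat {n k} (s : 'S_n) i : (0 < k)%N -> (i + k <= n)%N ->
  ar (cpat s i k) = cpat s i.+1 k.-1.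
Proof. by move=> k0 h; rewrite /ar cpat_cpat ?addn1 //; lia. Qed.

(** Size zero is allowed: it serves the empty vertex when [k] is 1 and the empty start of the
    induction in [approxM]. *)
Definition joinable B := forall m n (t : 'S_m) (s : 'S_n),
  avoids B t -> avoids B s -> exists r : 'S_(m + n),
    [/\ avoids B r, cpat r 0 m = t & cpat r m n = s].

Lemma perm0_eq (s t : 'S_0) : s = t.
Proof. by apply/permP => -[]. Qed.

(* The two sizes zero are not covered by [dsum_closed] and [ssum_closed]. *)
Lemma joinable_pos B :
  (forall m n (t : 'S_m.+1) (s : 'S_n.+1), avoids B t -> avoids B s ->
    exists r : 'S_(m.+1 + n.+1),
      [/\ avoids B r, cpat r 0 m.+1 = t & cpat r m.+1 n.+1 = s]) ->
  joinable B.
Proof.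
move=> H m n; case: n => [|n] t s tB sB.
  have: forall q, q = m -> exists r : 'S_q, [/\ avoids B r, cpat r 0 m = t & cpat r m 0 = s].
    by move=> q ->; exists t; split=> //; [exact: cpat_full | exact: perm0_eq].
  by apply; rewrite addn0.
case: m t tB => [|m] t tB; last exact: H.
by exists s; split=> //; [exact: perm0_eq | exact: cpat_full].
Qed.

Lemma pval_ostd {n f} : winj n f -> (forall a, (a < n)%N -> (f a < n)%N) ->
  forall i, (i < n)%N -> pval (ostd n f) i = f i.
Proof.
move=> fi fn i hi.
pose g (i : 'I_n) := Ordinal (fn i (ltn_ord i)).
have gi : injective g by move=> a b /(congr1 val) /= /fi h; apply: val_inj; exact: h.
have pg a : (a < n)%N -> pval (perm gi) a = f a.
  by move=> ha; rewrite -[a]/(val (Ordinal ha)) pvalE permE.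
by rewrite (ostd_uniq n (perm gi)) ?pg // => a b ha hb; rewrite !pg.
Qed.

(** * Direct and skew sums *)

Definition dword m (t s : nat -> nat) i :=
  if (i < m)%N then t i else (s (i - m) + m)%N.
Definition sword m n (t s : nat -> nat) i :=
  if (i < m)%N then (t i + n)%N else s (i - m)%N.

Section Joins.
Variables (m n : nat) (t : 'S_m) (s : 'S_n).

Lemma is_dsum_exists : exists r : 'S_(m + n), is_dsum t s r.
Proof.
have tl := pval_lt m t; have sl := pval_lt n s.
exists (ostd (m + n) (dword m (pval t) (pval s))).
apply/forallP => i; apply/eqP; rewrite pval_ostd //.
- move=> a b ha hb; rewrite /dword.
  have := tl a; have := tl b; have := sl (a - m)%N; have := sl (b - m)%N.
  case: (ltnP a m) => am; case: (ltnP b m) => bm h1 h2 h3 h4 e; try lia.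
    exact: (pval_winj _ t _ _ am bm).
  have := pval_winj _ s (a - m)%N (b - m)%N; lia.
- by move=> a ha; rewrite /dword; have := tl a; have := sl (a - m)%N; case: (ltnP a m); lia.
Qed.

Lemma is_ssum_exists : exists r : 'S_(m + n), is_ssum t s r.
Proof.
have tl := pval_lt m t; have sl := pval_lt n s.
exists (ostd (m + n) (sword m n (pval t) (pval s))).
apply/forallP => i; apply/eqP; rewrite pval_ostd //.
- move=> a b ha hb; rewrite /sword.
  have := tl a; have := tl b; have := sl (a - m)%N; have := sl (b - m)%N.
  case: (ltnP a m) => am; case: (ltnP b m) => bm h1 h2 h3 h4 e; try lia.
    apply: (pval_winj _ t _ _ am bm); lia.
  have := pval_winj _ s (a - m)%N (b - m)%N; lia.
- by move=> a ha; rewrite /sword; have := tl a; have := sl (a - m)%N; case: (ltnP a m); lia.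
Qed.

Variable r : 'S_(m + n).

Lemma is_dsumP : is_dsum t s r ->
  (forall i, (i < m)%N -> pval r i = pval t i) /\
  (forall i, (i < n)%N -> pval r (m + i) = (pval s i + m)%N).
Proof.
move=> /forallP h; split=> i hi.
  have hi' : (i < m + n)%N by lia.
  by have /eqP := h (Ordinal hi'); rewrite /= hi.
have hi' : (m + i < m + n)%N by lia.
by have /eqP := h (Ordinal hi'); rewrite /= ltnNge leq_addr /= addKn.
Qed.

Lemma is_ssumP : is_ssum t s r ->
  (forall i, (i < m)%N -> pval r i = (pval t i + n)%N) /\
  (forall i, (i < n)%N -> pval r (m + i) = pval s i).
Proof.
move=> /forallP h; split=> i hi.
  have hi' : (i < m + n)%N by lia.
  by have /eqP := h (Ordinal hi'); rewrite /= hi.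
have hi' : (m + i < m + n)%N by lia.
by have /eqP := h (Ordinal hi'); rewrite /= ltnNge leq_addr /= addKn.
Qed.

(** Each summand is only shifted by a constant, so both sums are joins. *)
Lemma sum_oiso : is_dsum t s r \/ is_ssum t s r ->
  oiso m (pval t) (pval r) /\ oiso n (pval s) (fun a => pval r (m + a)%N).
Proof.
case=> [/is_dsumP|/is_ssumP] [h1 h2]; split=> a b ha hb /=;
  first [by rewrite !h1 ?ltn_add2r | by rewrite !h2 ?ltn_add2r].
Qed.
End Joins.

Lemma closed_joinable B : dsum_closed B \/ ssum_closed B -> joinable B.
Proof.
move=> H; apply: joinable_pos => m n t s tB sB.
have [r [rB h]] : exists r : 'S_(m.+1 + n.+1), avoids B r /\ (is_dsum t s r \/ is_ssum t s r).
  case: H => H.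
    by have [r h] := is_dsum_exists _ _ t s; exists r; split; [exact: H h|left].
  by have [r h] := is_ssum_exists _ _ t s; exists r; split; [exact: H h|right].
have [h1 h2] := sum_oiso _ _ _ _ _ h.
by exists r; split=> //; [exact: (ostd_uniq _ _ _ h1) | exact: (ostd_uniq _ _ _ h2)].
Qed.

(** * Classes avoiding a single pattern *)

Lemma mem_single_B {m} (tau : 'S_m) (p : 'S_m) : (p \in single_B tau m) = (p == tau).
Proof.
rewrite inE eqxx /=; apply/forallP/eqP => [h|-> i]; last exact: eqxx.
by apply/permP => i; apply: val_inj; rewrite /= -!pvalE; apply/eqP.
Qed.

Lemma avoids_single {m n} (tau : 'S_m.+1) (s : 'S_n) :
  avoids (single_B tau) s <-> ~ contains tau s.
Proof.
split=> [h|h q p]; first by apply: h; rewrite mem_single_B.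
move=> pt pc; apply: h; have /andP[/eqP[e] _] : (q.+1 == m.+1) && true.
  by move: pt; rewrite inE => /andP[->].
by subst q; move: pt; rewrite mem_single_B => /eqP <-.
Qed.

(* An occurrence meeting both summands starts in the first and ends in the
   second one, which decides how its first and last values compare. *)
Lemma sum_contains {m n q} (tau : 'S_q.+1) (t : 'S_m) (s : 'S_n) (r : 'S_(m + n)) :
  is_dsum t s r \/ is_ssum t s r -> contains tau r ->
  [\/ contains tau t, contains tau s |
      if is_dsum t s r then (tau ord0 < tau ord_max)%N else (tau ord_max < tau ord0)%N].
Proof.
move=> h [f [fm /forallP fp]]; have [h1 h2] := sum_oiso _ _ _ _ _ h.
have fle (a b : 'I_q.+1) : (a <= b)%N -> (f a <= f b)%N.
  by rewrite leq_eqVlt => /orP[/eqP/val_inj->//|/fm/ltnW].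
have [fl|fl] := ltnP (f ord_max) m.
  have fa a : (f a < m)%N by apply: leq_ltn_trans fl; apply: fle; rewrite -ltnS ltn_ord.
  apply: Or31; exists (fun a => Ordinal (fa a)); split=> [a b /fm //|].
  apply/forallP => i; apply/forallP => j; have /forallP/(_ j)/eqP -> := fp i.
  by rewrite /= h1.
have [f0|f0] := leqP m (f ord0).
  have fa a : (f a - m < n)%N.
    by have := fle ord0 a (leq0n _); have := ltn_ord (f a); lia.
  apply: Or32; exists (fun a => Ordinal (fa a)); split=> [a b /fm|].
    by rewrite /=; have := fle ord0 a (leq0n _); lia.
  apply/forallP => i; apply/forallP => j; have /forallP/(_ j)/eqP -> := fp i.
  rewrite /= h2 // !subnKC //; by apply: leq_trans f0 (fle _ _ _).
apply: Or33.
have := ltn_ord (f ord_max) => fn.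
have fE : (f ord_max : nat) = (m + (f ord_max - m))%N by lia.
have fn' : (f ord_max - m < n)%N by lia.
have [/is_dsumP [g1 g2]|nd] := boolP (is_dsum t s r).
  have /forallP/(_ ord_max)/eqP /= -> := fp ord0.
  by rewrite (g1 _ f0) fE (g2 _ fn'); have := pval_lt _ t _ f0; lia.
have /is_ssumP [g1 g2] : is_ssum t s r by case: h => // h; rewrite h in nd.
have /forallP/(_ ord0)/eqP /= -> := fp ord_max.
by rewrite (g1 _ f0) fE (g2 _ fn'); have := pval_lt _ s _ fn'; lia.
Qed.

Lemma is_dsum_ssum {m n} (t : 'S_m.+1) (s : 'S_n.+1) r : is_dsum t s r -> ~ is_ssum t s r.
Proof.
move=> /is_dsumP [h1 _] /is_ssumP [h2 _].
by have := h1 0%N isT; have := h2 0%N isT; lia.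
Qed.

(** A pattern whose first value is below its last cannot straddle a skew sum, and any other pattern
    cannot straddle a direct sum. Size one, where both values coincide, falls in the second case. *)
Lemma single_closed {m} (tau : 'S_m.+1) :
  dsum_closed (single_B tau) \/ ssum_closed (single_B tau).
Proof.
have [h|h] := ltnP (tau ord0) (tau ord_max); [right|left]
  => p n t s r /avoids_single tB /avoids_single sB hr; apply/avoids_single => tr.
- case: (sum_contains tau t s r (or_intror hr) tr) => //.
  by case: ifP => [/is_dsum_ssum //|_]; lia.
- case: (sum_contains tau t s r (or_introl hr) tr) => //.
  by rewrite hr; lia.
Qed.

(** * Approximation of feasible vectors and convexity *)

(** Windows starting in the second part are those of [s]. Windows starting in the first part are
    those of [t], except the ones that cross the joint, which have at most [k] starting
    positions. *)
Lemma cocc_join {k m n} (p : 'S_k) (t : 'S_m) (s : 'S_n) (r : 'S_(m + n)) :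
  cpat r 0 m = t -> cpat r m n = s ->
  (cocc p t + cocc p s <= cocc p r <= cocc p t + cocc p s + k)%N.
Proof.
move=> rt rs; rewrite !coccE big_split_ord /=.
have -> : (\sum_(i < n) ((m + i + k <= m + n) && (cpat r (m + i) k == p)) =
           \sum_(i < n) ((i + k <= n) && (cpat s i k == p)))%N.
  apply: eq_bigr => i _; rewrite -addnA leq_add2l; case: leqP => //= h.
  by rewrite -rs cpat_cpat.
have cut (i : 'I_m) : (i + k <= m)%N -> cpat r i k = cpat t i k.
  by move=> h; rewrite -rt cpat_cpat // leq_addr.
set F := (fun i : nat => (i + k <= m + n) && (cpat r i k == p))%N.
set G := (fun i : nat => (i + k <= m) && (cpat t i k == p))%N.
have -> : (\sum_(i < m) ((i + k <= m + n) && (cpat r i k == p)) = \sum_(i < m) F i)%N by [].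
have lo : (\sum_(i < m) G i <= \sum_(i < m) F i)%N.
  apply: leq_sum => i _; rewrite /F /G; case: (leqP (i + k) m) => //= h.
  by rewrite cut // (leq_trans h (leq_addr _ _)).
have up : (\sum_(i < m) F i <= \sum_(i < m) G i + k)%N.
  apply: leq_trans (_ : \sum_(i < m) (G i + (m < i + k)) <= _)%N.
    apply: leq_sum => i _; rewrite /F /G; case: (leqP (i + k) m) => h /=.
      by rewrite cut // addn0; case: (i + k <= m + n)%N.
    by case: (_ && _).
  (* Counted backwards from the joint, the starting positions of crossing windows have index less
     than [k]. *)
  rewrite big_split leq_add2l /= (reindex_inj rev_ord_inj) /=.
  apply: leq_trans (_ : \sum_(i < m) (i < k) <= _)%N; last by rewrite sum_ltn_ord geq_minl.
  by apply: leq_sum => i _; have := ltn_ord i; lia.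
have -> : (\sum_(i < m) ((i + k <= m) && (cpat t i k == p)) = \sum_(i < m) G i)%N by [].
by rewrite leq_add2r lo addnAC leq_add2r up.
Qed.

Section Approx.
Variables (R : realType) (B : patset) (k : nat).
Implicit Types (x v w : 'S_k -> R) (e : R).

(** Counts are not divided by the size: joining then adds vectors and errors, with [k] more for the
    joint. *)
Definition approx n x e :=
  exists2 s : 'S_n, avoids B s & forall p, `|(cocc p s)%:R - x p| <= e.

Lemma approx0 : approx 0 (fun=> 0) 0.
Proof.
exists 1%g; first by move=> m p _ [f _]; case: (f ord0).
by move=> p; rewrite coccE big_ord0 subrr normr0.
Qed.

Hypothesis BJ : joinable B.

Lemma approxD n n' x x' e e' : approx n x e -> approx n' x' e' ->
  approx (n + n') (fun p => x p + x' p) (e + e' + k%:R).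
Proof.
move=> [t tB tx] [s sB sx]; have [r [rB rt rs]] := BJ _ _ t s tB sB.
exists r => // p; have /andP[] := cocc_join p t s r rt rs.
rewrite -!(ler_nat R) !natrD => h1 h2.
have := tx p; have := sx p; rewrite !ler_norml => /andP[? ?] /andP[? ?].
by apply/andP; split; lra.
Qed.

Lemma approxM a n x e : approx n x e ->
  approx (a * n) (fun p => a%:R * x p) (a%:R * (e + k%:R)).
Proof.
move=> h; elim: a => [|a IH].
  by rewrite mul0r; have := approx0; congr approx; apply/funext => p; rewrite mul0r.
have := approxD _ _ _ _ _ _ h IH; rewrite mulSn.
have -> : e + a%:R * (e + k%:R) + k%:R = a.+1%:R * (e + k%:R) by rewrite -natr1; lra.
by congr approx; apply/funext => p; rewrite -natr1; lra.
Qed.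

End Approx.
Arguments approx {R} B {k}.

(** Here [n] and [n'] are the sizes of the two permutations, [i / j] approximates [l], and [c] is a
    count in the joined permutation. In units of [n * n' * j * e], the given approximations cost 1,
    the joints after each copy 1, the final joint 1, and the rounding of [l] 1. *)
Lemma convex_combination_bound (R : realFieldType) (n n' i j k v w l e c : R) :
  0 <= k -> 1 <= n -> 1 <= n' -> k <= n * e -> k <= n' * e ->
  i <= l * j -> l * j < i + 1 -> 0 <= i <= j -> 1 <= j -> 1 <= j * e ->
  0 <= v <= 1 -> 0 <= w <= 1 ->
  `|c - (n' * i * (n * v) + n * (j - i) * (n' * w))|
    <= n' * i * (n * e + k) + n * (j - i) * (n' * e + k) + k ->
  `|c - n * n' * j * (l * v + (1 - l) * w)| <= n * n' * j * (4%:R * e).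
Proof.
move=> k0 n1 n'1 hn hn' il ir /andP[i0 ij] j1 je /andP[v0 v1] /andP[w0 w1].
set d := _ + n * (j - i) * (n' * w) => hc.
have -> : n * n' * j * (l * v + (1 - l) * w) = d + n * n' * ((l * j - i) * (v - w)).
  by rewrite /d; ring.
rewrite opprD addrA; apply: le_trans (ler_normB _ _) _.
have nn0 : 0 <= n * n' by apply: mulr_ge0; lra.
have e0 : 0 <= e.
  by rewrite -(@pmulr_rge0 _ j) ?(le_trans _ je) //; lra.
have t1 : `|n * n' * ((l * j - i) * (v - w))| <= n * n' * (j * e).
  rewrite normrM (ger0_norm nn0) ler_wpM2l //; apply: le_trans je.
  rewrite normrM -[leRHS]mulr1 ler_pM //.
    by rewrite ger0_norm; lra.
  by rewrite ler_norml; apply/andP; split; lra.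
apply: le_trans (lerD hc t1) _.
have a1 : n' * i * k <= n' * i * (n * e) by rewrite ler_wpM2l // mulr_ge0; lra.
have a2 : n * (j - i) * k <= n * (j - i) * (n' * e) by rewrite ler_wpM2l // mulr_ge0; lra.
have a3 : k <= n * n' * (j * e).
  apply: le_trans hn _; rewrite -mulrA; apply: ler_wpM2l; first lra.
  rewrite mulrA -[leLHS]mul1r; apply: ler_wpM2r => //.
  by apply: mulr_ege1.
have -> : n * n' * j * (4%:R * e) =
  n' * i * (n * e) + n' * i * (n * e) + (n * (j - i) * (n' * e) + n * (j - i) * (n' * e)) +
  n * n' * (j * e) + n * n' * (j * e) by ring.
by rewrite !mulrDr; lra.
Qed.

Section Feasible.
Variables (R : realType) (B : patset) (k : nat).
Implicit Types (x v w : 'S_k -> R) (e : R).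

(** Trades sequences for single long permutations, which can be joined. *)
Lemma feasibleP v : feasible R B k v <->
  (forall e, 0 < e -> forall N, exists n,
     [/\ (N <= n)%N, (0 < n)%N & approx B n (fun p => n%:R * v p) (n%:R * e)]).
Proof.
split=> [[s [sB [sN scv]]] e e0 N|H].
  have ev : \forall m \near \oo, forall p : 'S_k,
      `|v p - (cocc p (projT2 (s m)))%:R / (projT1 (s m))%:R| <= e.
    apply: filter_forall => p.
    by have /cvgrPdist_le/(_ e e0) := scv p.
  have [M hM] := sN N.
  have [M' _ hM'] := ev.
  have [[s0 sB'] sN'] := (sB (maxn M M'), hM _ (leq_maxl M M')).
  exists (projT1 (s (maxn M M'))); split=> //.
  exists (projT2 (s (maxn M M'))) => // p.
  have /(_ p) := hM' _ (leq_maxr M M').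
  set n := projT1 _ in s0 *; have n0 : 0 < n%:R :> R by rewrite ltr0n.
  rewrite distrC => h.
  have -> : (cocc p (projT2 (s (maxn M M'))))%:R - n%:R * v p =
    n%:R * ((cocc p (projT2 (s (maxn M M'))))%:R / n%:R - v p).
    by rewrite mulrBr mulrCA divff ?mulr1 ?gt_eqF.
  by rewrite normrM ger0_norm ?ler_pM2l // ltW.
(* Size at least [m] and error at most [1 / (m + 1)] at index [m] give a sequence with both required
   limits. *)
have {H} H m : exists u : {n : nat & 'S_n}, [/\ (m <= projT1 u)%N, (0 < projT1 u)%N,
    avoids B (projT2 u) & forall p : 'S_k,
    `|(cocc p (projT2 u))%:R / (projT1 u)%:R - v p| <= m.+1%:R^-1].
  have m0 : 0 < m.+1%:R^-1 :> R by rewrite invr_gt0 ltr0n.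
  have [n [mn n0 [s sB sv]]] := H _ m0 m.
  exists (existT _ n s); split=> // p /=.
  have n0' : 0 < n%:R :> R by rewrite ltr0n.
  rewrite -(ler_pM2l n0') -[X in X * `|_|](ger0_norm (ltW n0')) -normrM.
  by rewrite mulrBr mulrCA divff ?mulr1 ?gt_eqF //; exact: sv.
have [s hs] := choice H.
exists s; split; first by move=> m; have [] := hs m.
split.
  by move=> N; exists N => m hm; have [h _ _ _] := hs m; apply: leq_trans hm h.
move=> p; apply/cvgrPdist_le => e e0.
near=> m; rewrite distrC.
have [_ _ _ /(_ p) h] := hs m; apply: le_trans h _.
by apply: ltW; near: m; exact: (near_infty_natSinv_lt (PosNum e0)).
Unshelve. all: by end_near.
Qed.

(** There are finitely many coordinates, so a point of the closure has a feasible [w] within [e / 2]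
    in all of them at once. A permutation [e / 2]-close to [w] then serves the point itself. *)
Lemma feasible_closed : closed (feasible R B k : set {ptws 'S_k -> R}).
Proof.
move=> v cv; apply/feasibleP => e e0 N.
have e20 : 0 < e / 2 by rewrite divr_gt0.
pose G := nbhs (v : {ptws 'S_k -> R}).
have FG : Filter G by exact: nbhs_filter.
have Gv p : (fun w : {ptws 'S_k -> R} => (w : 'S_k -> R) p) @ G --> v p.
  exact: (@proj_continuous 'S_k (fun=> R) p v).
have Ge p : G (fun w : 'S_k -> R => `|v p - w p| <= e / 2).
  by have /cvgrPdist_le/(_ _ e20) := Gv p; exact.
have [w [/feasibleP fw vw]] := cv _ (filter_forall FG Ge).
have [n [Nn n0 [s sB sw]]] := fw _ e20 N.
exists n; split=> //; exists s => // p.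
have n0' : 0 < n%:R :> R by rewrite ltr0n.
have -> : (cocc p s)%:R - n%:R * v p = ((cocc p s)%:R - n%:R * w p) - n%:R * (v p - w p).
  by rewrite mulrBr; lra.
apply: le_trans (ler_normB _ _) _.
have -> : n%:R * e = n%:R * (e / 2) + n%:R * (e / 2) by rewrite -mulrDr -splitr.
by rewrite lerD // normrM (ger0_norm (ltW n0')) ler_pM2l.
Qed.

Lemma cocc_le n (p : 'S_k) (s : 'S_n) : (cocc p s <= n)%N.
Proof. by rewrite /cocc (leq_trans (max_card _)) ?card_ord. Qed.

Lemma feasible_unit : feasible R B k `<=` unit_box R k.
Proof.
move=> v /feasibleP fv p; suff h e : 0 < e -> - e <= v p <= 1 + e.
  apply/andP; split.
    by apply/ler_addgt0Pl => e /h /andP[+ _]; lra.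
  by apply/ler_addgt0Pr => e /h /andP[_].
move=> e0; have [n [_ n0 [s _ /(_ p)]]] := fv e e0 0%N.
have n0' : 0 < n%:R :> R by rewrite ltr0n.
have := cocc_le _ p s; rewrite -(ler_nat R) ler_norml => h /andP[h1 h2].
have c0 : 0 <= (cocc p s)%:R :> R by rewrite ler0n.
rewrite -(ler_pM2l n0') -[X in _ && X](ler_pM2l n0') mulrN mulrDr mulr1.
by apply/andP; split; lra.
Qed.

(* With |s| = n, |t| = n' and l ~ i / j, use n' i copies of s and n (j - i)
   copies of t; each joint costs at most k occurrences. *)
Lemma feasible_convex v w (l : R) : joinable B -> 0 <= l <= 1 ->
  feasible R B k v -> feasible R B k w ->
  feasible R B k (fun p => l * v p + (1 - l) * w p).
Proof.
move=> BJ /andP[l0 l1] fv fw; apply/feasibleP => e e0 N.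
have uv := feasible_unit _ fv; have uw := feasible_unit _ fw.
move: fv fw => /feasibleP fv /feasibleP fw.
pose e4 := e / 4%:R; have e40 : 0 < e4 by rewrite divr_gt0.
(* For sizes [n >= M], the cost [k] of a joint is at most [n * e4]. *)
pose M := (maxn N (Num.truncn (k%:R / e4))).+1.
have Me n : (M <= n)%N -> k%:R <= n%:R * e4.
  move=> Mn; rewrite -ler_pdivrMr //; apply: ltW; apply: lt_le_trans (truncnS_gt _) _.
  by rewrite ler_nat; apply: leq_trans Mn; rewrite ltnS leq_maxr.
have [n [Mn n0 sv]] := fv _ e40 M.
have [n' [Mn' n'0 tw]] := fw _ e40 M.
(* The fraction [i / j] approximates [l] from below within [1 / j], which is at most [e4]. *)
pose j := (Num.truncn e4^-1).+1; pose i := Num.truncn (l * j%:R).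
have j0 : 0 < j%:R :> R by rewrite ltr0n.
have je : 1 <= j%:R * e4.
  by rewrite -ler_pdivrMr // mul1r; apply: ltW; exact: truncnS_gt.
have lj0 : 0 <= l * j%:R by rewrite mulr_ge0 // ltW.
have /andP[il ir] := truncn_itv lj0.
have ij : (i <= j)%N by rewrite -(ler_nat R) (le_trans il) // ler_piMl // ltW.
have := approxD _ _ _ BJ _ _ _ _ _ _ (approxM _ _ _ BJ (n' * i) _ _ _ sv)
  (approxM _ _ _ BJ (n * (j - i)) _ _ _ tw).
(* The crossed factors [n'] and [n] compensate for the different sizes: the two kinds of copies fill
   exactly [i / j] and [(j - i) / j] of the total length. *)
set nn := (_ + _)%N; have nnE : nn = (n * n' * j)%N.
  rewrite /nn -{2}(subnKC ij); nia.
have nnN : (N <= nn)%N.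
  have : (N < n)%N by apply: leq_trans Mn; rewrite ltnS leq_maxl.
  by move=> /ltnW/leq_trans; apply; rewrite nnE -mulnA leq_pmulr // muln_gt0 n'0.
have nn0 : (0 < nn)%N by rewrite nnE !muln_gt0 n0 n'0.
move=> [r rB hr]; exists nn; split=> //; exists r => // p.
have {hr} := hr p.
set c := (cocc p r)%:R.
rewrite !natrM (natrB _ ij) => hr.
have -> : nn%:R = n%:R * n'%:R * j%:R :> R by rewrite nnE !natrM.
have -> : e = 4%:R * e4 by rewrite /e4 mulrC divfK // pnatr_eq0.
apply: (convex_combination_bound _ _ _ i%:R _ k%:R);
  rewrite ?ler1n ?ler0n ?ler_nat //; first [exact: Me | exact: uv | exact: uw | by rewrite natr1].
Qed.

End Feasible.

(** * Circulations and simple cycles *)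

Lemma iter_eventually_cycle (T : finType) (f : T -> T) (x : T) :
  exists j d, iter d.+1 f (iter j f x) = iter j f x.
Proof.
have /trajectP[j jo e] := looping_order f x.
exists j, (fingraph.order f x - j.+1)%N.
by rewrite -iterD -e; congr (iter _ f x); lia.
Qed.

Section Cycles.
Variables (B : patset) (k : nat).
Implicit Types (C : seq 'S_k) (v : 'S_k -> nat).

(** The cyclic shift of indices matches each arrival with the next departure. *)
Lemma simple_cycle_flow C u : simple_cycle B C ->
  count (fun p => st p == u) C = count (fun p => ar p == u) C.
Proof.
move=> [_ _ Cc _ _]; rewrite -!sum1_count (big_nth 1%g) [RHS](big_nth 1%g) !big_mkord.
rewrite big_mkcond [RHS]big_mkcond (reindex_inj (@ordS_inj _)) /=; apply: eq_bigr => i _.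
by rewrite Cc addn1.
Qed.

Lemma sum_count_mem C (P : pred 'S_k) : (\sum_(p | P p) count_mem p C = count P C)%N.
Proof.
elim: C => [|c C IH] /=; first by rewrite big1.
rewrite big_split /= IH; congr addn; rewrite big_mkcond (bigD1 c) //= eqxx big1 ?addn0.
  by case: (P c).
by move=> i /negbTE; rewrite eq_sym => ->; case: ifP.
Qed.

(* Leaving each vertex by a fixed edge makes the walk eventually periodic, and
   no vertex is repeated within a period. *)
Lemma simple_cycle_exists (S : {set 'S_k}) p0 : p0 \in S -> S \subset Av B k ->
  (forall p, p \in S -> exists2 q, q \in S & st q = ar p) ->
  exists2 C, simple_cycle B C & {subset C <= S}.
Proof.
move=> p0S SAv Snext.
pose g u : 'S_k := odflt 1%g [pick q | (q \in S) && (st q == u)].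
pose f p := g (ar p).
have fP p : p \in S -> (f p \in S) /\ st (f p) = ar p.
  move=> /Snext [q qS stq]; rewrite /f /g; case: pickP => [r /andP[rS /eqP]//|].
  by move=> /(_ q); rewrite qS stq eqxx.
have itS i : iter i f p0 \in S by elim: i => //= i /fP[].
have [j [d jd]] := iter_eventually_cycle _ f p0; set y := iter j f p0 in jd.
have yS i : iter i f y \in S by rewrite /y -iterD itS.
have yo : iter (fingraph.order f y) f y = y.
  by apply/(orbitPcycle 3 4); exists d.
have fy i : exists2 z, z \in S & iter i f y = f z.
  case: i => [|i]; last by exists (iter i f y).
  by exists (iter d f y) => //; rewrite -[LHS]jd.
pose C := fingraph.orbit f y.
have sC : size C = fingraph.order f y by rewrite size_traject.
have CS : {subset C <= S} by move=> q /trajectP[i _ ->].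
have nC i : (i < size C)%N -> nth 1%g C i = iter i f y.
  by move=> h; rewrite (set_nth_default y) // nth_traject // -sC.
exists C => //; split.
- by rewrite -size_eq0 sC -lt0n fingraph.order_gt0.
- by apply/allP => q /CS /(fintype.subsetP SAv).
- move=> i; have i1 : ((i + 1) %% size C < size C)%N by rewrite ltn_mod sC fingraph.order_gt0.
  rewrite !nC // -(proj2 (fP _ (yS _))); congr st.
  have [h|h] := ltnP (i + 1)%N (size C); first by rewrite modn_small // addn1.
  have e : i.+1 = size C by apply/eqP; rewrite eqn_leq ltn_ord -addn1 h.
  by rewrite addn1 e modnn /= -iterS e sC yo.
- exact: orbit_uniq.
(* Every edge of the period is a value of [f], hence equals [g] of its own start vertex; so equal
   starts force equal edges. *)
- rewrite map_inj_in_uniq ?orbit_uniq // => q1 q2 /trajectP[i1 _ ->] /trajectP[i2 _ ->].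
  have [z1 z1S ->] := fy i1; have [z2 z2S ->] := fy i2.
  by rewrite (proj2 (fP _ z1S)) (proj2 (fP _ z2S)) /f => ->.
Qed.

End Cycles.

Section Circulation.
Variables (R : realType) (B : patset) (k : nat).
Implicit Types (v w : 'S_k -> R).

Definition circulation v :=
  [/\ forall p, 0 <= v p, forall p, p \notin Av B k -> v p = 0
    & forall u, \sum_(p | st p == u) v p = \sum_(p | ar p == u) v p].

Lemma sum_cycle_vec (C : seq 'S_k) : C != [::] -> \sum_p cycle_vec R C p = 1.
Proof.
move=> C0; rewrite -mulr_suml -natr_sum (sum_count_mem _ _ xpredT) count_predT divff //.
by rewrite pnatr_eq0 size_eq0.
Qed.

(** By conservation, a positive edge into a vertex forces a positive edge out of it, so the support
    satisfies the condition of [simple_cycle_exists]. *)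
Lemma circulation_cycle v p0 : circulation v -> v p0 != 0 ->
  exists2 C, simple_cycle B C & forall p, p \in C -> 0 < v p.
Proof.
move=> [v0 vAv vflow] p0v.
have [||q qS|C hC CS] := @simple_cycle_exists B k [set p | v p != 0]%SET p0; first by rewrite inE.
- by apply/fintype.subsetP => p; rewrite inE; apply: contraNT => /vAv ->.
- rewrite inE in qS.
  have := vflow (ar q); rewrite [RHS](bigD1 q) //= => h.
  have : \sum_(p | st p == ar q) v p != 0.
    rewrite h gt_eqF // ltr_wpDr ?sumr_ge0 // lt_neqAle eq_sym qS v0 //.
  have [/existsP[r /andP[/eqP rq rv]] _|no] := boolP [exists r, (st r == ar q) && (v r != 0)].
    by exists r; rewrite ?inE.
  rewrite big1 ?eqxx // => r hr; apply: contraNeq no => rv.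
  by apply/existsP; exists r; rewrite hr.
- by exists C => // p /CS; rewrite inE lt_neqAle eq_sym v0 => ->.
Qed.

Lemma circulation_sub_cycle v C a : circulation v -> simple_cycle B C ->
  (forall p, p \in C -> a <= v p) ->
  circulation (fun p => v p - a * (count_mem p C)%:R).
Proof.
move=> [v0 vAv vflow] hC aC; have [C0 CAv _ Cu _] := hC; split.
- move=> p; rewrite count_uniq_mem //; have [pC|_] := boolP (p \in C).
    by rewrite mulr1 subr_ge0 aC.
  by rewrite mulr0 subr0.
- move=> p pAv; rewrite vAv // count_uniq_mem //.
  have /negbTE-> : p \notin C by apply: contra pAv => /(allP CAv).
  by rewrite mulr0 subr0.
- move=> u; rewrite !sumrB vflow -!mulr_sumr -!natr_sum !sum_count_mem.
  by rewrite (simple_cycle_flow _ _ _ _ hC).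
Qed.

Lemma circulation_decomp v : circulation v ->
  exists l : seq (R * seq 'S_k),
    (forall x, x \in l -> 0 <= x.1 /\ simple_cycle B x.2) /\
    (forall p, v p = \sum_(x <- l) x.1 * cycle_vec R x.2 p).
Proof.
have [n] := ubnP #|[set p | v p != 0]%SET|.
elim: n v => // n IH v; rewrite ltnS => vn cv.
have [/existsP[p0 p0v]|no] := boolP [exists p, v p != 0]; last first.
  exists [::]; split=> // p; rewrite big_nil.
  by apply: contraNeq no => pv; apply/existsP; exists p.
have [C hC Cv] := circulation_cycle v p0 cv p0v.
have [C0 CAv _ Cu _] := hC.
have [c0 c0C] : exists c0, c0 \in C by case: (C) C0 => // c s _; exists c; rewrite mem_head.
(* An edge of least weight on the cycle leaves the support after the subtraction, so the induction
   on the support proceeds. *)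
have [q qC qmin] := @Order.TotalTheory.arg_minP _ R _ c0 (mem C) v c0C.
have cv' := circulation_sub_cycle v C (v q) cv hC qmin.
have [|l [hl vl]] := IH _ _ cv'.
  apply: leq_trans vn; apply: proper_card; apply/properP; split.
    apply/fintype.subsetP => p; rewrite !inE; apply: contraNN => /eqP pv.
    have pC : p \notin C by apply/negP => /Cv; rewrite pv ltxx.
    by rewrite count_uniq_mem // (negbTE pC) mulr0 subr0 pv.
  exists q; first by rewrite inE gt_eqF // Cv.
  have {}qC : q \in C := qC.
  by rewrite inE count_uniq_mem // qC mulr1 subrr eqxx.
(* The factor [size C] undoes the normalization of [cycle_vec]. *)
exists ((v q * (size C)%:R, C) :: l); split.
  move=> x; rewrite inE => /orP[/eqP ->|/hl //]; split=> //=.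
  by rewrite mulr_ge0 // ltW // Cv.
move=> p; rewrite big_cons -vl /cycle_vec /=.
have sC : (size C)%:R != 0 :> R by rewrite pnatr_eq0 size_eq0.
by field.
Qed.

(** Every cycle vector has total mass 1, so the weights of the decomposition sum to the mass of
    [v]. *)
Lemma circulation_cycle_polytope v : circulation v -> \sum_p v p = 1 ->
  cycle_polytope R B k v.
Proof.
move=> cv v1; have [l [hl vl]] := circulation_decomp v cv.
pose x0 : R * seq 'S_k := (0, [::]).
have hn (i : 'I_(size l)) := hl _ (mem_nth x0 (ltn_ord i)).
exists (size l), (fun i => (nth x0 l i).1), (fun i => cycle_vec R (nth x0 l i).2); split.
- by move=> i; have [] := hn i.
- rewrite -v1; under [RHS]eq_bigr do rewrite vl.
  rewrite exchange_big (big_nth x0) big_mkord; apply: eq_bigr => i _.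
  rewrite -mulr_sumr sum_cycle_vec ?mulr1 //.
  by have [_ []] := hn i.
- by move=> i; exists (nth x0 l i).2 => //; have [] := hn i.
- by move=> t; rewrite vl (big_nth x0) big_mkord.
Qed.

(** * Linear constraints on feasible vectors *)

Lemma sum_cocc n (s : 'S_n) (a : 'S_k -> R) :
  \sum_p a p * (cocc p s)%:R = \sum_(i < n | (i + k <= n)%N) a (cpat s i k).
Proof.
under eq_bigr do rewrite coccE natr_sum mulr_sumr.
rewrite exchange_big [RHS]big_mkcond /=; apply: eq_bigr => i _.
case: leqP => _ /=; last by rewrite big1 // => p _; rewrite mulr0.
rewrite (bigD1 (cpat s i k)) //= eqxx mulr1 big1 ?addr0 // => p.
by rewrite eq_sym => /negbTE ->; rewrite mulr0.
Qed.

Hypothesis k0 : (0 < k)%N.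

Lemma sum_cocc_windows n (s : 'S_n) (a : 'S_k -> R) : (k <= n)%N ->
  \sum_p a p * (cocc p s)%:R = \sum_(i < (n - k).+1) a (cpat s i k).
Proof.
move=> kn; rewrite sum_cocc (big_ord_widen n (fun i => a (cpat s i k))); last by lia.
by apply: eq_bigl => i; lia.
Qed.

(** Common source of mass, conservation and support: a linear form of the counts that stays within a
    constant [D] of [n * b] has the limit [b] after division by [n]. *)
Lemma feasible_linear (a : 'S_k -> R) b D v :
  (forall n (s : 'S_n), (k <= n)%N -> avoids B s ->
     `|\sum_p a p * (cocc p s)%:R - n%:R * b| <= D) ->
  feasible R B k v -> \sum_p a p * v p = b.
Proof.
move=> H /feasibleP fv; apply/eqP; rewrite -subr_eq0 -normr_le0.
apply/ler_addgt0Pr => e e0; rewrite add0r.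
pose A := \sum_p `|a p|; have A0 : 0 <= A by apply: sumr_ge0.
(* The summand 1 avoids division by 0 when [a] vanishes; the weighted coordinate errors add up to at
   most [e / 2]. *)
pose e2 := e / 2%:R / (A + 1).
have e20 : 0 < e2 by rewrite !divr_gt0 // ltr_wpDl.
have [n [Nn n0 [s sB sv]]] := fv e2 e20 (maxn k (Num.truncn (D / (e / 2%:R))).+1).
have kn : (k <= n)%N by apply: leq_trans Nn; exact: leq_maxl.
have n0' : 0 < n%:R :> R by rewrite ltr0n.
have Dn : D <= n%:R * (e / 2%:R).
  rewrite -ler_pdivrMr ?divr_gt0 //; apply: ltW; apply: lt_le_trans (truncnS_gt _) _.
  by rewrite ler_nat; apply: leq_trans Nn; rewrite leq_maxr.
have Ae : n%:R * e2 * A <= n%:R * (e / 2%:R).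
  rewrite -mulrA ler_pM2l // /e2 -mulrA ler_piMr ?divr_ge0 ?ltW //.
  by rewrite mulrC ltr_pdivrMr ?ltr_wpDl // mul1r ltrDl.
have E : n%:R * (\sum_p a p * v p - b) =
    (\sum_p a p * (cocc p s)%:R - n%:R * b) - \sum_p a p * ((cocc p s)%:R - n%:R * v p).
  have -> : \sum_p a p * ((cocc p s)%:R - n%:R * v p) =
     \sum_p a p * (cocc p s)%:R - n%:R * \sum_p a p * v p.
    rewrite mulr_sumr -sumrB; apply: eq_bigr => p _; ring.
  ring.
rewrite -(ler_pM2l n0') -{1}(ger0_norm (ltW n0')) -normrM E.
apply: le_trans (ler_normB _ _) _.
have -> : n%:R * e = n%:R * (e / 2%:R) + n%:R * (e / 2%:R) by rewrite -mulrDr -splitr.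
apply: lerD; first exact: le_trans (H _ _ kn sB) Dn.
apply: le_trans Ae; apply: le_trans (ler_norm_sum _ _ _) _.
rewrite /A mulr_sumr; apply: ler_sum => p _.
by rewrite normrM mulrC ler_wpM2r.
Qed.

(** There are [n - k + 1] windows, which is within [k] of [n]. *)
Lemma feasible_sum v : feasible R B k v -> \sum_p v p = 1.
Proof.
move=> fv; rewrite -[RHS](feasible_linear (fun=> 1) 1 k%:R v _ fv).
  by apply: eq_bigr => p _; rewrite mul1r.
move=> n s kn _; rewrite sum_cocc_windows // sumr_const card_ord mulr1.
rewrite -natr1 natrB // ler_norml; have : 1 <= k%:R :> R by rewrite ler1n.
by move=> ?; apply/andP; split; lra.
Qed.

(** Along the walk of windows, departures from [u] minus arrivals at [u] telescope to a difference
    of two indicators, bounded by 1. *)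
Lemma feasible_flow v u : feasible R B k v ->
  \sum_(p | st p == u) v p = \sum_(p | ar p == u) v p.
Proof.
move=> fv; apply/eqP; rewrite -subr_eq0.
rewrite -[X in _ == X](feasible_linear (fun p => (st p == u)%:R - (ar p == u)%:R) 0 1 v _ fv).
  rewrite (big_mkcond (fun p => st p == u)) (big_mkcond (fun p => ar p == u)) -sumrB.
  apply/eqP; apply: eq_bigr => p _; rewrite mulrBl.
  by case: (_ == _); case: (_ == _); rewrite ?mul1r ?mul0r.
move=> n s kn _; rewrite sum_cocc_windows // mulr0 subr0.
have -> : \sum_(i < (n - k).+1)
      ((st (cpat s i k) == u)%:R - (ar (cpat s i k) == u)%:R) =
    - \sum_(0 <= i < (n - k).+1)
      ((cpat s i.+1 k.-1 == u)%:R - (cpat s i k.-1 == u)%:R) :> R.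
  rewrite big_mkord -sumrN; apply: eq_bigr => i _.
  have ik : (i + k <= n)%N by have := ltn_ord i; lia.
  by rewrite st_cpat // ar_cpat // opprB.
rewrite (telescope_sumr (fun i => (cpat s i k.-1 == u)%:R : R)) // normrN.
by case: (_ == _); case: (_ == _); rewrite ?subrr ?subr0 ?sub0r ?normrN ?normr0 ?normr1.
Qed.

Lemma feasible_support v p : feasible R B k v -> p \notin Av B k -> v p = 0.
Proof.
move=> fv pAv; rewrite -[RHS](feasible_linear (fun q => (q == p)%:R) 0 0 v _ fv).
  rewrite (bigD1 p) //= eqxx mul1r big1 ?addr0 // => q /negbTE ->.
  by rewrite mul0r.
move=> n s kn sB; rewrite sum_cocc_windows // mulr0 subr0 big1 ?normr0 // => i _.
case: eqP => // ps; case/negP: pAv; rewrite -ps; apply/AvP/avoids_cpat => //.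
by have := ltn_ord i; lia.
Qed.

Lemma feasible_circulation v : feasible R B k v -> circulation v.
Proof.
move=> fv; split.
- by move=> p; have /andP[] := feasible_unit _ _ _ _ fv p.
- by move=> p; apply: feasible_support.
- by move=> u; apply: feasible_flow.
Qed.

End Circulation.

(** * Walks in the overlap graph are realized *)

Section Realization.
Variables (k : nat) (C : seq 'S_k).
Hypothesis k0 : (0 < k)%N.
Hypothesis C0 : C != [::].
Hypothesis Cwalk : forall i : 'I_(size C),
  ar (nth 1%g C i) = st (nth 1%g C ((i + 1) %% size C)).

(** The cycle unrolled into an infinite periodic walk. *)
Let e i := nth 1%g C (i %% size C).

Let ar_e i : ar (e i) = st (e i.+1).
Proof.
have sC : (0 < size C)%N by rewrite lt0n size_eq0.
have im : (i %% size C < size C)%N by rewrite ltn_mod.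
by rewrite /e (Cwalk (Ordinal im)) /= modnDml addn1.
Qed.

(** Appending [c] first moves the values at or above [c] up by one, through [bump]. *)
Let append n c (f : nat -> nat) j := if (j < n)%N then bump c (f j) else c.

Let bump_lt c x y : (bump c x < bump c y)%N = (x < y)%N.
Proof. by rewrite /bump; lia. Qed.

Let append_winj n c f : winj n f -> winj n.+1 (append n c f).
Proof.
move=> fi a b ha hb; rewrite /append.
case: (ltnP a n) => an; case: (ltnP b n) => bn.
- by move=> h; apply: fi => //; move: h; rewrite /bump; lia.
- by move/eqP; rewrite eq_sym (negbTE (neq_bump _ _)).
- by move/eqP; rewrite (negbTE (neq_bump _ _)).
- by move=> _; lia.
Qed.

Let append_old n c f i l : (i + l <= n)%N ->
  oiso l (fun a => f (i + a)%N) (fun a => append n c f (i + a)%N).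
Proof.
move=> h a b ha hb; rewrite /append.
have -> : (i + a < n)%N by lia.
have -> : (i + b < n)%N by lia.
by rewrite bump_lt.
Qed.

(* The new value goes just above those of the last k - 1 values that p puts
   below its last one. *)
Let extend L (f : nat -> nat) (p : 'S_k) : winj (L + k.-1) f ->
  ostd k.-1 (fun a => f (L + a)%N) = st p ->
  exists c, ostd k (fun a => append (L + k.-1) c f (L + a)%N) = p.
Proof.
move=> fi fp.
have pst : oiso k.-1 (fun a => f (L + a)%N) (pval p).
  apply: oiso_trans (oiso_sym _ _ _ (ostd_oiso k.-1 _ _)) _.
    by apply: winj_shift fi _; lia.
  by rewrite fp; exact: (@cpat_oiso k p 0 k.-1 (leq_pred _)).
(* The empty maximum is 0: if the last value of [p] is its smallest, the new value goes below all
   others. *)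
pose c := (\max_(a < k.-1 | pval p a < pval p k.-1) (f (L + a)%N).+1)%N.
have cP a : (a < k.-1)%N -> (f (L + a) < c)%N = (pval p a < pval p k.-1)%N.
  move=> ak; apply/idP/idP => [fc|pa]; last first.
    exact: (@leq_bigmax_cond _ _ (fun a : 'I_k.-1 => (f (L + a)%N).+1) (Ordinal ak)).
  have [/existsP[a0 pa0]|no] := boolP [exists a : 'I_k.-1, pval p a < pval p k.-1]%N; last first.
    move: fc; rewrite /c big_pred0 // => b; apply/negbTE.
    by apply: contra no => pb; apply/existsP; exists b.
  have [|b pb cb] := @eq_bigmax_cond _ (fun a : 'I_k.-1 => pval p a < pval p k.-1)%N
     (fun a : 'I_k.-1 => (f (L + a)%N).+1).
    by apply/card_gt0P; exists a0.
  move: fc; rewrite /c cb ltnS leqNgt (pst b a) // -leqNgt => le.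
  exact: leq_ltn_trans le pb.
exists c; apply: ostd_uniq => a b ha hb; rewrite /append.
rewrite !ltn_add2l.
have [ak|ak] := ltnP a k.-1; have [bk|bk] := ltnP b k.-1.
- by rewrite bump_lt pst.
- have -> : b = k.-1 by lia.
  by rewrite -cP // /bump; lia.
- have -> : a = k.-1 by lia.
  have := cP b bk; have : pval p b <> pval p k.-1.
    by move=> /(pval_winj _ p) h; have := h (leq_trans bk (leq_pred _)); lia.
  by rewrite /bump; lia.
- have -> : a = k.-1 by lia.
  have -> : b = k.-1 by lia.
  by rewrite !ltnn.
Qed.

(** The third clause is the invariant that lets [extend] append the next edge: the last [k - 1]
    letters already form its start. *)
Lemma walk_word L : exists f, [/\ winj (L + k.-1) f,
  forall i, (i < L)%N -> ostd k (fun a => f (i + a)%N) = e i &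
  ostd k.-1 (fun a => f (L + a)%N) = st (e L)].
Proof.
elim: L => [|L [f [fi fe fL]]].
  exists (pval (st (e 0))); split=> //; first exact: pval_winj.
  exact: ostd_uniq.
have [c fc] := extend L f (e L) fi fL.
have ai := append_winj _ c _ fi.
exists (append (L + k.-1) c f); split=> //.
- move=> i; rewrite ltnS leq_eqVlt => /orP[/eqP ->//|iL].
  rewrite -(fe i iL); apply: ostd_ext; apply: oiso_sym; apply: append_old; lia.
- rewrite -ar_e -fc /ar cpatE.
  rewrite -[RHS]cpatE ostd_sub; [|by apply: winj_shift ai _; lia|by lia].
  by apply: ostd_ext => a b _ _; rewrite !addnA !addn1.
Qed.

Lemma cycle_vec_feasible (R : realType) : feasible R noB k (cycle_vec R C).
Proof.
apply/feasibleP => eps eps0 N.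
have sC : (0 < size C)%N by rewrite lt0n size_eq0.
pose M := (maxn N (Num.truncn (k%:R / eps))).+1.
(* [M] turns around the cycle, plus the [k - 1] letters that complete the last windows. The counts
   are exact, so only these extra letters cause an error, and [k <= M * eps] absorbs it. *)
pose n := (size C * M + k.-1)%N.
have [f [fi fe _]] := walk_word (size C * M).
have Mn : (M <= n)%N by apply: leq_trans (leq_addr _ _); exact: leq_pmull.
have n0 : (0 < n)%N by apply: leq_trans Mn.
exists n; split=> //; first by apply: leq_trans Mn; apply: leqW; exact: leq_maxl.
exists (ostd n f); first by move=> q p; rewrite inE.
move=> p; set s := ostd n f.
have winE X j : (j < X)%N -> (j + k <= X + k.-1)%N by move: k0; clear; lia.
have sumE m : (\sum_(i < size C * m) (e i == p) = m * count_mem p C)%N.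
  elim: m => [|m IH]; first by rewrite muln0 big_ord0.
  rewrite mulnS addnC big_split_ord /= IH mulSn addnC; congr addn.
  rewrite -sum1_count (big_nth 1%g) big_mkord [RHS]big_mkcond /=.
  apply: eq_bigr => i _; by rewrite /e mulnC modnMDl modn_small //; case: eqP.
have cE : cocc p s = (M * count_mem p C)%N.
  rewrite coccE.
  transitivity (\sum_(i < size C * M) (e i == p))%N.
    rewrite (big_ord_widen n (fun i => (e i == p : nat))); last exact: leq_addr.
    rewrite [RHS]big_mkcond; apply: eq_bigr => i _.
    have -> : (i + k <= n)%N = (i < size C * M)%N by rewrite /n; lia.
    case: ltnP => //= h; rewrite -(fe _ h) /s ostd_sub //. exact: winE.
  exact: sumE.
rewrite cE /cycle_vec !natrM /n natrD natrM.
have sC0 : (size C)%:R != 0 :> R by rewrite pnatr_eq0 -lt0n.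
have -> : M%:R * (count_mem p C)%:R -
   ((size C)%:R * M%:R + k.-1%:R) * ((count_mem p C)%:R / (size C)%:R) =
   - (k.-1%:R * ((count_mem p C)%:R / (size C)%:R)) :> R by field.
rewrite normrN ger0_norm ?mulr_ge0 ?divr_ge0 //.
have c1 : (count_mem p C)%:R / (size C)%:R <= 1 :> R.
  by rewrite ler_pdivrMr ?ltr0n // mul1r ler_nat count_size.
apply: le_trans (_ : k%:R <= _).
  rewrite -[leRHS]mulr1 ler_pM ?divr_ge0 // ler_nat leq_pred //.
apply: le_trans (_ : M%:R * eps <= _); last first.
  by rewrite ler_pM2r // -natrM -natrD ler_nat.
rewrite -ler_pdivrMr //; apply: ltW; apply: lt_le_trans (truncnS_gt _) _.
by rewrite ler_nat ltnS leq_maxr.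
Qed.

End Realization.

(** * Convex hulls of feasible vectors *)

Lemma noB_joinable : joinable noB.
Proof.
apply: closed_joinable; left=> m n t s r _ _ _ q p.
by rewrite inE.
Qed.

(** Induction on the number of points: the first point is combined with the renormalized combination
    of the others. *)
Lemma conv_hull_feasible (R : realType) B k (S : set ('S_k -> R)) : joinable B ->
  S `<=` feasible R B k -> conv_hull S `<=` feasible R B k.
Proof.
move=> BJ SF x [m [w [y [w0 w1 Sy xE]]]].
have {xE} -> : x = fun t => \sum_i w i * y i t by apply/funext.
elim: m w y w0 w1 Sy => [|m IH] w y w0 w1 Sy.
  by move: w1; rewrite big_ord0 => /esym/eqP; rewrite oner_eq0.
rewrite big_ord_recl in w1.
set u := \sum_(i < m) _ in w1.
have u0 : 0 <= u by apply: sumr_ge0 => i _.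
(* Weights of sum 0 cannot be renormalized; in that case the first point carries all the weight. *)
have [uz|unz] := eqVneq u 0.
  have wz (i : 'I_m) : w (lift ord0 i) = 0.
    have /psumr_eq0P := uz; apply=> // j _; exact: w0.
  have -> : (fun t => \sum_i w i * y i t) = y ord0.
    apply/funext => t; rewrite big_ord_recl big1 => [|i _]; last by rewrite wz mul0r.
    by move: w1; rewrite uz !addr0 => ->; rewrite mul1r.
  exact/SF.
have -> : (fun t => \sum_i w i * y i t) = fun t => w ord0 * y ord0 t +
    (1 - w ord0) * \sum_(i < m) (w (lift ord0 i) / u) * y (lift ord0 i) t.
  apply/funext => t; rewrite big_ord_recl; congr (_ + _).
  have -> : 1 - w ord0 = u by rewrite -w1 addrC addKr.
  rewrite mulr_sumr; apply: eq_bigr => i _.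
  by rewrite mulrA [u * _]mulrC divfK.
apply: feasible_convex => //.
- by rewrite w0 -w1 lerDl.
- exact/SF.
- apply: (IH (fun i => w (lift ord0 i) / u) (fun i => y (lift ord0 i))).
  + by move=> i; rewrite divr_ge0.
  + by rewrite -mulr_suml divff.
  + by move=> i.
Qed.

Lemma cycle_polytope_feasible (R : realType) B k : (0 < k)%N ->
  cycle_polytope R B k `<=` feasible R noB k.
Proof.
move=> k0; apply: conv_hull_feasible; first exact: noB_joinable.
by move=> _ [C [C0 _ Cw _ _] <-]; exact: cycle_vec_feasible.
Qed.

(** * Dimension *)

Section Dimension.
Variables (R : realType) (B : patset) (k : nat).
Hypothesis k0 : (0 < k)%N.
Hypothesis BJ : joinable B.

(** Gives the bound -1 that [dim_le] demands. For [k >= 2] the start map is onto: joining a vertex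
    to itself yields an edge leaving it. For [k = 1] the difference is -1 when [B] excludes size
    one. *)
Lemma card_Av_pred : (#|Av B k.-1| <= #|Av B k|)%N \/ k = 1%N /\ #|Av B k.-1| = 1%N.
Proof.
have [k1|k1] := leqP k 1.
  have -> : k = 1%N by lia.
  right; split=> //; apply/eqP/cards1P; exists 1%g; apply/setP => s.
  by rewrite (perm0_eq s 1%g) set11; apply/AvP => m p _ [f _]; case: (f ord0).
left; apply: leq_trans (leq_imset_card (@st k) _); apply: subset_leq_card.
apply/fintype.subsetP => u /AvP uB; have [r [rB ru _]] := BJ _ _ u u uB uB.
have kk : (0 + k <= k.-1 + k.-1)%N by lia.
apply/imsetP; exists (cpat r 0 k); first by apply/AvP; exact: avoids_cpat.
by rewrite st_cpat // -[LHS]ru.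
Qed.

Lemma window_edge n (r : 'S_n) i : (i + k <= n)%N -> avoids B r ->
  [/\ cpat r i k \in Av B k, st (cpat r i k) = cpat r i k.-1 &
      ar (cpat r i k) = cpat r i.+1 k.-1].
Proof.
by move=> h rB; split; [apply/AvP; exact: avoids_cpat|exact: st_cpat|exact: ar_cpat].
Qed.

(** The potential grows by [d] at each step of the walk of windows. *)
Lemma potential_window (c : 'S_k.-1 -> R) d n (r : 'S_n) j :
  (forall p, p \in Av B k -> c (st p) - c (ar p) + d = 0) ->
  avoids B r -> (j + k.-1 <= n)%N -> c (cpat r j k.-1) = c (cpat r 0 k.-1) + j%:R * d.
Proof.
move=> H rB; elim: j => [|j IH] jn; first by rewrite mul0r addr0.
have jk : (j + k <= n)%N by lia.
have [eAv es ea] := window_edge n r j jk rB.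
have jn' : (j + k.-1 <= n)%N by lia.
by have := H _ eAv; rewrite es ea (IH jn') -natr1; lra.
Qed.

(* Joins make the overlap graph strongly connected. *)
Lemma potential_const (c : 'S_k.-1 -> R) d :
  (forall p, p \in Av B k -> c (st p) - c (ar p) + d = 0) ->
  (exists p, p \in Av B k) ->
  d = 0 /\ (forall u w, u \in Av B k.-1 -> w \in Av B k.-1 -> c u = c w).
Proof.
move=> H [p /AvP pB].
have d0 : d = 0.
  (* Joining [p] to itself gives a closed walk of [k] steps, whence [k * d = 0]. *)
  have [r [rB r1 r2]] := BJ _ _ p p pB pB.
  have h1 : (0 + k.-1 <= k)%N by lia.
  have e0 : cpat r 0 k.-1 = cpat r k k.-1.
    have e1 := cpat_cpat r 0 k 0 k.-1 (leq_addr _ _) (leq_pred k).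
    have e2 := cpat_cpat r k k 0 k.-1 (leqnn _) (leq_pred k).
    by rewrite addn0 r2 in e2; rewrite r1 in e1; rewrite -e2 e1.
  have h2 : (k + k.-1 <= k + k)%N by rewrite leq_add2l leq_pred.
  have := potential_window c d _ r k H rB h2; rewrite -e0.
  move/eqP; rewrite -subr_eq0 opprD addrA subrr sub0r oppr_eq0 mulf_eq0 pnatr_eq0.
  by rewrite (gtn_eqF k0) => /eqP.
split=> // u w /AvP uB /AvP wB; have [r [rB r1 r2]] := BJ _ _ u w uB wB.
have := potential_window c d _ r k.-1 H rB (leqnn _).
by rewrite r1 r2 d0 mulr0 addr0.
Qed.

(* Constraint matrix of the tangent space: flow conservation at every vertex
   but u0, whose redundant row is replaced by the total mass. *)
Lemma feasible_dim : dim_le (feasible R B k) (#|Av B k|%:Z - #|Av B k.-1|%:Z).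
Proof.
split; first by case: card_Av_pred => [|[_ ->]]; lia.
move=> [v0 fv0] m x y xy.
have [p0 p0Av] : exists p, p \in Av B k.
  have [/existsP//|no] := boolP [exists p, p \in Av B k].
  have := feasible_sum R B k k0 v0 fv0; rewrite big1 => [/eqP|p _].
    by rewrite eq_sym oner_eq0.
  apply: feasible_support fv0 _ => //; apply: contra no => pAv.
  by apply/existsP; exists p.
pose u0 := st p0.
have stAv p : p \in Av B k -> st p \in Av B k.-1.
  by move=> /AvP pB; apply/AvP; apply: avoids_cpat pB; lia.
have arAv p : p \in Av B k -> ar p \in Av B k.-1.
  by move=> /AvP pB; apply/AvP; apply: avoids_cpat pB; lia.
have u0Av : u0 \in Av B k.-1 := stAv _ p0Av.
pose D := \matrix_(i < m, j < #|{: 'S_k}|) (x i (enum_val j) - y i (enum_val j)).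
(* [D'] keeps only the columns indexed by [Av B k]; [Z] puts the zero columns back, so the rank does
   not grow. *)
pose D' := \matrix_(i < m, j < #|Av B k|) (x i (enum_val j) - y i (enum_val j)).
pose Z : 'M[R]_(#|Av B k|, #|{: 'S_k}|) :=
  \matrix_(i, j) ((enum_val i : 'S_k) == enum_val j)%:R.
pose M : 'M[R]_(#|Av B k|, #|Av B k.-1|) := \matrix_(i, j)
  if (enum_val j : 'S_k.-1) == u0 then 1
  else (st (enum_val i) == enum_val j)%:R - (ar (enum_val i) == enum_val j)%:R.
have dAv i p : p \notin Av B k -> x i p - y i p = 0.
  have [fx fy] := xy i => pAv.
  by rewrite (feasible_support _ _ _ k0 _ _ fx pAv) (feasible_support _ _ _ k0 _ _ fy pAv) subrr.
have sumAv (F : 'S_k -> R) : \sum_(j < #|Av B k|) F (enum_val j) = \sum_(p in Av B k) F p.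
  by rewrite [RHS]big_enum_val.
have DZ : D = D' *m Z.
  apply/matrixP => i j; rewrite !mxE.
  under eq_bigr do rewrite !mxE.
  rewrite (sumAv (fun p => (x i p - y i p) * (p == enum_val j)%:R)).
  have [jAv|jAv] := boolP (enum_val j \in Av B k).
    rewrite (bigD1 (enum_val j)) //= eqxx mulr1 big1 ?addr0 // => p /andP[_ /negbTE ->].
    by rewrite mulr0.
  rewrite dAv // big1 // => p pAv; have [e|_] := eqVneq p (enum_val j); last by rewrite mulr0.
  by rewrite -e pAv in jAv.
have DM : D' *m M = 0.
  apply/matrixP => i j; rewrite !mxE.
  under eq_bigr do rewrite !mxE.
  have [fx fy] := xy i.
  have full (F : 'S_k -> R) : \sum_(p in Av B k) (x i p - y i p) * F p = \sum_p (x i p - y i p) * F p.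
    rewrite [LHS]big_mkcond; apply: eq_bigr => p _; case: ifPn => // /dAv ->.
    by rewrite mul0r.
  rewrite (sumAv (fun p => (x i p - y i p) * if enum_val j == u0 then 1
    else (st p == enum_val j)%:R - (ar p == enum_val j)%:R)) full.
  case: (enum_val j == u0).
    under eq_bigr do rewrite mulr1.
    by rewrite sumrB !(feasible_sum R B k) // subrr.
  have ind (P : pred 'S_k) : \sum_p (x i p - y i p) * (P p)%:R =
      \sum_(p | P p) x i p - \sum_(p | P p) y i p.
    rewrite -sumrB [RHS]big_mkcond; apply: eq_bigr => p _.
    by case: (P p); rewrite ?mulr1 ?mulr0.
  under eq_bigr do rewrite mulrBr.
  rewrite sumrB (ind (fun p => st p == enum_val j)) (ind (fun p => ar p == enum_val j)).
  by rewrite (feasible_flow _ _ _ k0 _ _ fx) (feasible_flow _ _ _ k0 _ _ fy) subrr.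
(* A linear relation among the constraints is a potential [g], zero at [u0], whose slope is the
   coefficient of the total mass. By [potential_const] the slope vanishes and [g] is constant, hence
   zero. *)
have Mfree : row_free M^T.
  rewrite -kermx_eq0; apply/eqP/row_matrixP => i; rewrite row0.
  set c := row i _; have cM : c *m M^T = 0 by rewrite -row_mul mulmx_ker row0.
  pose g u := if u == u0 then 0 else
    \sum_(j < #|Av B k.-1|) c 0 j * (u == enum_val j)%:R.
  have gE j : enum_val j != u0 -> g (enum_val j) = c 0 j.
    move=> ju; rewrite /g (negbTE ju) (bigD1 j) //= eqxx mulr1 big1 ?addr0 // => l lj.
    by rewrite (inj_eq enum_val_inj) eq_sym (negbTE lj) mulr0.
  pose j0 := enum_rank_in u0Av u0.
  have j0E : enum_val j0 = u0 by rewrite enum_rankK_in.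
  have gsum u : u \in Av B k.-1 ->
      g u = \sum_(j | j != j0) c 0 j * (u == enum_val j)%:R.
    move=> uAv; rewrite -(enum_rankK_in u0Av uAv); set l := enum_rank_in _ _.
    have [lu|lu] := eqVneq (enum_val l) u0.
      rewrite /g lu eqxx big1 // => j jj0; rewrite -j0E (inj_eq enum_val_inj).
      by rewrite eq_sym (negbTE jj0) mulr0.
    rewrite gE // (bigD1 l) /=; last by apply: contraNneq lu => ->; rewrite j0E.
    rewrite eqxx mulr1 big1 ?addr0 // => j /andP[_ jl].
    by rewrite (inj_eq enum_val_inj) eq_sym (negbTE jl) mulr0.
  have pot p : p \in Av B k -> g (st p) - g (ar p) + c 0 j0 = 0.
    move=> pAv; have /matrixP/(_ 0 (enum_rank_in p0Av p)) := cM.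
    rewrite !mxE (bigD1 j0) //= !mxE j0E eqxx mulr1 => E.
    rewrite -[RHS]E addrC; congr (_ + _).
    rewrite (gsum _ (stAv _ pAv)) (gsum _ (arAv _ pAv)) -sumrB; apply: eq_bigr => j jj0.
    rewrite !mxE enum_rankK_in // ifF ?mulrBr //.
    by rewrite -j0E (inj_eq enum_val_inj) (negbTE jj0).
  have [c0 gc] := potential_const g (c 0 j0) pot (ex_intro _ p0 p0Av).
  apply/rowP => j; rewrite [RHS]mxE.
  have [ju|ju] := eqVneq (enum_val j) u0.
    by rewrite (_ : j = j0) //; apply: enum_val_inj; rewrite j0E.
  by rewrite -(gE _ ju) (gc _ u0) ?enum_valP // /g eqxx.
(* As [D' *m M = 0], the ranks of [D'] and [M] add up to at most [#|Av B k|], and [M] has full rank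
   [#|Av B k.-1|]. *)
have := mulmx0_rank_max DM; rewrite -(mxrank_tr M) (eqP Mfree) => rk.
have : (\rank D <= \rank D')%N by rewrite DZ mxrankM_maxl.
by rewrite -/D; lia.
Qed.

End Dimension.

Lemma feasible_convex_set (R : realType) B k : joinable B ->
  convex_set (feasible R B k : set (convex_lmodType ('S_k -> R))).
Proof.
move=> BJ x y l; rewrite !inE => fx fy.
have l01 : 0 <= l%:num <= 1 by rewrite ge0 le1.
exact: (feasible_convex R B k x y l%:num BJ l01 fx fy).
Qed.

Theorem mainTheorem1 (R : realType) (k : nat) (B : patset) :
  (0 < k)%N ->
  [/\ closed (feasible R B k : set {ptws 'S_k -> R}),
       feasible R B k `<=` unit_box R k,
       feasible R B k `<=` cycle_polytope R B k &
       cycle_polytope R B k `<=` feasible R noB k] /\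
  ((dsum_closed B \/ ssum_closed B) ->
     convex_set (feasible R B k : set (convex_lmodType ('S_k -> R))) /\
     dim_le (feasible R B k) (#|Av B k|%:Z - #|Av B k.-1|%:Z)) /\
  (forall m (tau : 'S_m.+1),
     convex_set (feasible R (single_B tau) k
                   : set (convex_lmodType ('S_k -> R)))).
Proof.
move=> k0; split; last split.
- split; [exact: feasible_closed | exact: feasible_unit | | exact: cycle_polytope_feasible].
  move=> v fv; apply: circulation_cycle_polytope; first exact: feasible_circulation.
  exact: feasible_sum fv.
- move=> /closed_joinable BJ; split; first exact: feasible_convex_set.
  exact: feasible_dim.
- by move=> m tau; apply: feasible_convex_set; apply: closed_joinable; exact: single_closed.
Qed.
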